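(* Let $d\ge1$ and let $T$ be a rectangular rank one $\mathbb Z^d$ action. Then there is a one-dimensional linear subspace $V$ of $\mathbb R^d$ such that $h_1(T,V)=0$.
   Context: Shapes and rectangles. A shape is a (nonempty) finite subset of $\mathbb Z^d$. For $\vec m,\vec n\in\mathbb Z^d$ with $\vec n\ge\vec m$ coordinatewise, the rectangle $[\vec m,\vec n]$ is the shape $\{\vec v\in\mathbb Z^d:\vec m\le\vec v\le\vec n\}$. A sequence $\{R_k\}$ of shapes is a F\o lner sequence if for every $\vec n\in\mathbb Z^d$, $\lim_{k\to\infty}|R_k\triangle(R_k+\vec n)|/|R_k|=0$. Partitions. $(X,\mathcal A,\mu)$ is a Lebesgue probability space. A partition $\mathcal P$ with finite alphabet $L$ is a measurable map $X\to L$, identified with the labeled family of atoms $P_a=\mathcal P^{-1}(a)$, $a\in L$. For partitions $\mathcal P_k$ with alphabets $L_k$, $\mathcal P_k\to\epsilon$ means that for every $A\in\mathcal A$ there exist $I_k\subseteq L_k$ with $\mu\big((\bigcup_{a\in I_k}(P_k)_a)\triangle A\big)\to0$. The join $\mathcal P\vee\mathcal Q$ is the partition into the sets $P_a\cap Q_b$. Entropy: $H(\mathcal P)=-\sum_{a}\mu(P_a)\log\mu(P_a)$, with $0\log0=0$. Towers and rank one. Let $T$ be a free measure preserving $\mathbb Z^d$ action on $(X,\mathcal A,\mu)$. Given a shape $R$ and $B\in\mathcal A$ with $\mu(B)>0$ such that the sets $T^{\vec v}B$, $\vec v\in R$, are pairwise disjoint, the $T$-tower of shape $R$ and base $B$ is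 the partition $\{T^{\vec v}B:\vec v\in R\}\cup\{E\}$, where $E=(\bigcup_{\vec v\in R}T^{\vec v}B)^c$ is the error set; $T^{\vec v}B$ is labeled $\vec v$ and $E$ is labeled $\vec\epsilon=\frac12(1,\dots,1)$. For a sequence of shapes $\mathcal R=\{R_k\}$, $T$ is $\mathcal R$ rank one if $T$ is such a free action and there is a sequence $\mathcal P_k$ of $T$-towers of shape $R_k$ with $\mathcal P_k\to\epsilon$. $T$ is rectangular rank one if it is $\mathcal R$ rank one for some F\o lner sequence $\mathcal R$ of rectangles. Directional entropy. For $d>1$ and a one-dimensional subspace $V\subset\mathbb R^d$, let $Q$ be the unit cube (unit-length segment) in $V$ and $Q'$ the unit cube in $V^\perp$ centered at $\vec0$ (with respect to orthonormal bases), let $S(V,t,m)=tQ+mQ'$, and for a finite partition $\mathcal P$ let $\mathcal P_{V,t,m}=\bigvee_{\vec w\in S(V,t,m)\cap\mathbb Z^d}T^{-\vec w}\mathcal P$. Put $h_1(T,V,\mathcal P,m)=\limsup_{t\to\infty}t^{-1}H(\mathcal P_{V,t,m})$, $h_1(T,V,\mathcal P)=\sup_{m>0}h_1(T,V,\mathcal P,m)$, and $h_1(T,V)=\sup_{\mathcal P\text{ finite}}h_1(T,V,\mathcal P)$. For $d=1$, $V=\mathbb R$, $h_1(T,\mathbb R)$ is the usual entropy of $T$. *)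

(* Defs.v *)
From HB Require Import structures.
From mathcomp Require Import all_boot all_order all_algebra finmap.
From mathcomp Require Import all_classical all_reals all_analysis.
From mathcomp Require Import measurable_realfun.
Import Order.TTheory GRing.Theory Num.Theory numFieldNormedType.Exports.

Set Implicit Arguments.
Unset Strict Implicit.
Unset Printing Implicit Defensive.

Local Open Scope classical_set_scope.
Local Open Scope ring_scope.

(* Lebesgue probability spaces, in the sense of Rohlin: complete, and
   isomorphic mod 0 to the completion of the Borel measure nu given by an
   interval [0, s] with Lebesgue measure together with countably many atoms
   (the n-th one, of mass p n, is placed at -(n + 1)).  The isomorphism is an
   injective map phi on a set X0 of full measure. *)
Definition lebesgue_space (R : realType) (disp : measure_display)
    (X : measurableType disp) (mu : probability X R) : Prop :=
  measure_is_complete mu /\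
  exists (s : R) (p : nat -> R)
         (nu : {measure set (measurableTypeR R) -> \bar R})
         (X0 : set X) (phi : X -> measurableTypeR R),
    [/\ 0 <= s /\ (forall n, 0 <= p n),
        (forall C, measurable C ->
           nu C = (lebesgue_measure (C `&` `[0%R, s]) +
                   \sum_(n <oo) (p n)%:E * \d_(- n.+1%:R : R)%R C)%E),
        [/\ measurable X0, mu X0 = 1%E & set_inj X0 phi],
        measurable_fun X0 phi /\
        (forall C, measurable C -> mu (X0 `&` phi @^-1` C) = nu C) &
        (forall A, measurable A -> A `<=` X0 ->
           completed_algebra_gen nu (phi @` A))].

Section Shapes.
Variable d : nat.
Implicit Types S : {fset 'rV[int]_d}.

Definition is_rectangle S : Prop :=
  exists m n : 'rV[int]_d,
    (forall i, m 0 i <= n 0 i) /\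
    (forall v, v \in S = [forall i, m 0 i <= v 0 i <= n 0 i]).

Definition translate S (n : 'rV[int]_d) : {fset 'rV[int]_d} :=
  [fset (v + n)%R | v in S]%fset.

Definition folner (R : realType) (Rk : nat -> {fset 'rV[int]_d}) : Prop :=
  (forall k, Rk k != fset0) /\
  forall n : 'rV[int]_d,
    #|` ((Rk k `\` translate (Rk k) n) `|` (translate (Rk k) n `\` Rk k))%fset|%:R
      / #|` Rk k|%:R @[k --> \oo] --> (0 : R).

End Shapes.

Section Partitions.
Context (R : realType) (disp : measure_display) (X : measurableType disp).
Variable mu : probability X R.

Definition is_partition (L : finType) (P : X -> L) : Prop :=
  forall a, measurable (P @^-1` [set a]).

Definition entropy (L : finType) (P : X -> L) : R :=
  - \sum_(a : L) fine (mu (P @^-1` [set a])) * ln (fine (mu (P @^-1` [set a]))).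

Definition cvg_to_points (L : nat -> finType) (P : forall k, X -> L k) : Prop :=
  forall A, measurable A ->
    exists I : forall k, {set L k},
      mu ((\bigcup_(a in [set` I k]) (P k @^-1` [set a])) `+` A)
        @[k --> \oo] --> 0%E.

End Partitions.

Section Actions.
Context (R : realType) (disp : measure_display) (X : measurableType disp).
Variable mu : probability X R.
Variable d : nat.
Variable T : 'rV[int]_d -> X -> X.

Definition free_mp_action : Prop :=
  [/\ (forall x, T 0 x = x) /\ (forall v w x, T (v + w) x = T v (T w x)),
      forall v, measurable_fun setT (T v),
      forall v A, measurable A -> mu (T v @^-1` A) = mu A &
      {ae mu, forall x, forall v, v != 0 -> T v x <> x}].

(* The label None stands for the label of the error set. *)
Definition is_tower (S : {fset 'rV[int]_d}) (B : set X) (P : X -> option S)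
    : Prop :=
  [/\ measurable B, (0 < mu B)%E,
      trivIset [set` S] (fun v => T v @` B),
      (forall v : S, P @^-1` [set Some v] = T (val v) @` B) &
      P @^-1` [set None] = ~` \bigcup_(v in [set` S]) (T v @` B)].

Definition rank_one (Rk : nat -> {fset 'rV[int]_d}) : Prop :=
  free_mp_action /\
  exists P : forall k, X -> option (Rk k),
    (forall k, exists B, is_tower B (P k)) /\
    cvg_to_points mu (L := fun k => option (Rk k)) P.

Definition rectangular_rank_one : Prop :=
  exists Rk : nat -> {fset 'rV[int]_d},
    [/\ forall k, is_rectangle (Rk k), folner R Rk & rank_one Rk].

(* The join of the partitions T^{-w_i} P, i in I.  As a labeling map, T^{-w} P
   (whose atoms are the sets T^{-w} P_a) is x |-> P (T^w x). *)
Definition action_join (I L : finType) (w : I -> 'rV[int]_d) (P : X -> L)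
    : X -> {ffun I -> L} :=
  fun x => [ffun i => P (T (w i) x)].

Definition orth_compl (V : {vspace 'rV[R]_d}) : set 'rV[R]_d :=
  [set x | forall y, y \in V -> x *m y^T = 0].

(* The rows of B are an orthonormal basis of the subspace W. *)
Definition orthonormal_basis (k : nat) (W : set 'rV[R]_d) (B : 'M[R]_(k, d))
    : Prop :=
  B *m B^T = 1%:M /\ W = [set c *m B | c in [set: 'rV[R]_k]].

Definition cube (k : nat) (B : 'M[R]_(k, d)) (a b : R) : set 'rV[R]_d :=
  [set c *m B | c in [set c : 'rV[R]_k | forall i, a <= c 0 i <= b]].

(* S(V,t,m), where the row v is an orthonormal basis of V and U one of the
   orthogonal complement of V. *)
Definition window (v : 'rV[R]_d) (U : 'M[R]_(d.-1, d)) (t m : R)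
    : set 'rV[R]_d :=
  [set t *: q + m *: q' | q in cube v 0 1 & q' in cube U (- 2^-1) 2^-1].

(* fset_set of a set is meaningful only if that set is finite, as it is here
   because windows are bounded. *)
Definition window_points (v : 'rV[R]_d) (U : 'M[R]_(d.-1, d)) (t m : R)
    : {fset 'rV[int]_d} :=
  fset_set [set w : 'rV[int]_d | window v U t m (map_mx intr w)].

Definition window_join (L : finType) (P : X -> L)
    (v : 'rV[R]_d) (U : 'M[R]_(d.-1, d)) (t m : R)
    : X -> {ffun window_points v U t m -> L} :=
  action_join val P.

Definition dir_entropy_width (v : 'rV[R]_d) (U : 'M[R]_(d.-1, d))
    (L : finType) (P : X -> L) (m : R) : \bar R :=
  limf_esup (fun t : R => (t^-1 * entropy mu (window_join P v U t m))%:E)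
            (pinfty_nbhs R).

Definition dir_entropy_part (v : 'rV[R]_d) (U : 'M[R]_(d.-1, d))
    (L : finType) (P : X -> L) : \bar R :=
  ereal_sup [set dir_entropy_width v U P m | m in [set m : R | 0 < m]].

Definition dir_entropy (v : 'rV[R]_d) (U : 'M[R]_(d.-1, d)) : \bar R :=
  ereal_sup [set h | exists (L : finType) (P : X -> L),
                       is_partition P /\ h = dir_entropy_part v U P].

(* The usual entropy of the transformation T^(1,...,1); used for d = 1. *)
Definition ks_entropy_part (L : finType) (P : X -> L) : \bar R :=
  limn_esup (fun n : nat =>
    (n%:R^-1 *
     entropy mu (action_join (fun i : 'I_n => const_mx (i%:Z)) P))%:E).

Definition ks_entropy : \bar R :=
  ereal_sup [set h | exists (L : finType) (P : X -> L),
                       is_partition P /\ h = ks_entropy_part P].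

(* h_1(T, V), computed with the orthonormal bases v of V and U of its
   orthogonal complement; its value does not depend on these bases. *)
Definition h1 (v : 'rV[R]_d) (U : 'M[R]_(d.-1, d)) : \bar R :=
  if d == 1%N then ks_entropy else dir_entropy v U.

End Actions.

(* Main.v *)
(** Let [e_i] be the direction which is the longest side of infinitely many of
    the rectangles [R_k], and [s] the length of that side.  In a window of [s]
    consecutive steps along [e_i] every stay in a single copy of [R_k] contains
    one of the two ends of the window, so the labels of the tower partition
    [P_k] at these two ends determine all the others: the window has entropy at
    most [2 ln (|R_k| + 1)], which is [O(ln s)] since [|R_k| <= s ^ d], and
    [s] is unbounded by the Folner condition.  An arbitrary finite partition is
    determined by [P_k] together with a partition of small entropy which
    records its value on a small error set only.  Hence the entropy along [e_i]
    vanishes, and widening the window in the orthogonal directions only replaces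
    a partition by another finite partition. *)
Require Import Defs.
From HB Require Import structures.
From mathcomp Require Import all_boot all_order all_algebra finmap.
From mathcomp Require Import all_classical all_reals all_analysis.
From mathcomp Require Import zify ring lra.
Import Order.TTheory GRing.Theory Num.Theory numFieldNormedType.Exports.
Local Open Scope classical_set_scope.
Local Open Scope ring_scope.

(** * Entropy of finite partitions *)

Section Entropy.
Context {R : realType}.

Lemma ln_le_sub1 {x : R} : 0 < x -> ln x <= x - 1.
Proof. by move=> x0; rewrite -{1}(subrKC 1 x) le_ln1Dx // ltrBrDl subrr. Qed.

(** Summing [ln x <= x - 1] at [x = q i / p i], weighted by [p i]. As [ln 0] is [0] here, the last
    hypothesis excludes the terms that should be infinite. *)
Lemma gibbs {I : finType} {p q : I -> R} :
  (forall i, 0 <= p i) -> (forall i, 0 <= q i) ->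
  \sum_i q i <= \sum_i p i -> (forall i, q i = 0 -> p i = 0) ->
  - (\sum_i p i * ln (p i)) <= - (\sum_i p i * ln (q i)).
Proof.
move=> p0 q0 qp q0p0; rewrite lerN2 -subr_le0 -sumrB.
apply: (@le_trans _ _ (\sum_i (q i - p i))); last by rewrite sumrB subr_le0.
apply: ler_sum => i _; have [->|pi0] := eqVneq (p i) 0.
  by rewrite !mul0r !subr0.
have pi_gt0 : 0 < p i by rewrite lt0r pi0 p0.
have qi_gt0 : 0 < q i.
  by rewrite lt0r q0 andbT; apply: contra_neq pi0 => /q0p0.
rewrite -mulrBr -ln_div ?posrE //.
have /(ler_wpM2l (p0 i)) := ln_le_sub1 (divr_gt0 qi_gt0 pi_gt0).
by rewrite mulrBr mulr1 mulrCA divff // mulr1.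
Qed.

Context {disp : measure_display} {X : measurableType disp}.
Variable mu : probability X R.

Notation pr P a := (fine (mu (P @^-1` [set a]))).

Lemma fin_mu {A} : measurable A -> mu A \is a fin_num.
Proof. exact: fin_num_measure. Qed.

Lemma sum_measureI {L : finType} {P : X -> L} {B : set X} :
  is_partition P -> measurable B ->
  \sum_a fine (mu (B `&` P @^-1` [set a])) = fine (mu B).
Proof.
move=> mP mB; have mBP a : measurable (B `&` P @^-1` [set a]).
  exact: measurableI.
rewrite sum_fine => [|a _]; last exact: fin_mu.
congr fine; rewrite -big_enum /= fsbig_seq ?enum_uniq // -measure_fin_bigcup //.
- congr (mu _); apply/seteqP; split => [x [a _ []] //|x Bx].
  by exists (P x); rewrite /= ?mem_enum.
- by move=> a b _ _ [x [[_ /= <-] [_ /= <-]]].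
Qed.

Lemma pr_ge0 (L : finType) (P : X -> L) a : 0 <= pr P a.
Proof. exact: fine_ge0. Qed.

Lemma sum_pr {L : finType} {P : X -> L} : is_partition P -> \sum_a pr P a = 1.
Proof.
move=> mP; rewrite -[RHS]/(fine 1%E) -(probability_setT mu).
rewrite -(sum_measureI mP measurableT); apply: eq_bigr => a _.
by rewrite setTI.
Qed.

Lemma le_fine_mu {A B} : measurable A -> measurable B -> A `<=` B ->
  fine (mu A) <= fine (mu B).
Proof. by move=> mA mB AB; rewrite fine_le ?fin_mu// le_measure ?inE. Qed.

Lemma pr_le1 {L : finType} {P : X -> L} a : is_partition P -> pr P a <= 1.
Proof.
move=> mP; rewrite -[leRHS]/(fine 1%E) -(probability_setT mu).
by apply: le_fine_mu.
Qed.

Lemma entropy_ge0 {L : finType} {P : X -> L} :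
  is_partition P -> 0 <= entropy mu P.
Proof.
move=> mP; rewrite /entropy oppr_ge0; apply: sumr_le0 => a _.
by rewrite mulr_ge0_le0 ?pr_ge0 // ln_le0 // pr_le1.
Qed.

Lemma entropy_le_card {L : finType} {P : X -> L} :
  is_partition P -> entropy mu P <= ln (#|L|%:R).
Proof.
move=> mP; have c0 : (0 < #|L|)%N.
  rewrite lt0n; apply/eqP => L0; have := sum_pr mP.
  by rewrite big_pred0 => [/eqP|/fintype0 /(_ L0) //]; rewrite eq_sym oner_eq0.
(* Gibbs' inequality against the uniform distribution. *)
have -> : ln (#|L|%:R) = - \sum_a pr P a * ln (#|L|%:R^-1 : R).
  by rewrite -mulr_suml sum_pr // mul1r lnV ?posrE ?ltr0n // opprK.
have ci : 0 < #|L|%:R^-1 :> R by rewrite invr_gt0 ltr0n.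
apply: gibbs => [a|a||a].
- exact: pr_ge0.
- exact: ltW.
- by rewrite sum_pr // sumr_const -[_ *+ _]mulr_natl divff // pnatr_eq0 -lt0n.
- by move=> e; move: (lt0r_neq0 ci); rewrite e eqxx.
Qed.

Lemma preimage_pair (L M : Type) (f : X -> L) (g : X -> M) a b :
  (fun x => (f x, g x)) @^-1` [set (a, b)] = f @^-1` [set a] `&` g @^-1` [set b].
Proof. by apply/seteqP; split=> x /= [-> ->]. Qed.

Lemma partition_pair {L M : finType} {f : X -> L} {g : X -> M} :
  is_partition f -> is_partition g -> is_partition (fun x => (f x, g x)).
Proof. by move=> mf mg [a b]; rewrite preimage_pair; apply: measurableI. Qed.

(** Every atom of [g] lies inside an atom of [f], of at least the same mass, and [ln] is
    monotone. *)
Lemma entropy_determined {L M : finType} {f : X -> L} {g : X -> M} :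
  is_partition f -> is_partition g ->
  (forall x y, g x = g y -> f x = f y) -> entropy mu f <= entropy mu g.
Proof.
move=> mf mg gf; rewrite /entropy lerN2.
under eq_bigr do rewrite -(sum_measureI mf) // mulr_suml.
rewrite exchange_big /=; apply: ler_sum => b _.
rewrite -[leRHS]/(pr f b * _) -(sum_measureI mg (mf b)) mulr_suml.
apply: ler_sum => a _; rewrite setIC.
have [->|/set0P [x [/= fx gx]]] :=
  eqVneq (f @^-1` [set b] `&` g @^-1` [set a]) set0.
  by rewrite measure0 !mul0r.
have fg : g @^-1` [set a] `<=` f @^-1` [set b].
  by move=> y /= gy; rewrite -fx; apply: gf; rewrite gx.
rewrite (setIidr fg) (sum_measureI mf (mg a)) (sum_measureI mg (mf b)).
have [->|n0] := eqVneq (pr g a) 0; first by rewrite !mul0r.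
have ? : 0 < pr g a by rewrite lt0r n0 pr_ge0.
have le : pr g a <= pr f b by exact: le_fine_mu.
by rewrite ler_pM2l // ler_ln ?posrE // (lt_le_trans _ le).
Qed.

Lemma entropy_pair {L M : finType} {f : X -> L} {g : X -> M} :
  is_partition f -> is_partition g ->
  entropy mu (fun x => (f x, g x)) <= entropy mu f + entropy mu g.
Proof.
move=> mf mg; have mfg := partition_pair mf mg.
have le1 a b : pr (fun x => (f x, g x)) (a, b) <= pr f a.
  by apply: le_fine_mu => //; rewrite preimage_pair => x [].
have le2 a b : pr (fun x => (f x, g x)) (a, b) <= pr g b.
  by apply: le_fine_mu => //; rewrite preimage_pair => x [].
(* Gibbs' inequality against the product of the marginals. *)
have -> : entropy mu f + entropy mu g =
  - \sum_(c : L * M) pr (fun x => (f x, g x)) c * ln (pr f c.1 * pr g c.2).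
  rewrite /entropy -opprD; congr (- _).
  transitivity (\sum_a \sum_b (pr (fun x => (f x, g x)) (a, b) * ln (pr f a) +
                 pr (fun x => (f x, g x)) (a, b) * ln (pr g b))).
    under [RHS]eq_bigr do rewrite big_split.
    rewrite big_split /= [X in _ = _ + X]exchange_big /=; congr (_ + _).
      apply: eq_bigr => a _; rewrite -mulr_suml -(sum_measureI mg (mf a)).
      by under [in RHS]eq_bigr do rewrite preimage_pair.
    apply: eq_bigr => b _; rewrite -mulr_suml -(sum_measureI mf (mg b)).
    by under [in RHS]eq_bigr do rewrite preimage_pair setIC.
  rewrite pair_bigA; apply: eq_bigr => -[a b] _ /=.
  have [->|n0] := eqVneq (pr (fun x => (f x, g x)) (a, b)) 0.
    by rewrite !mul0r addr0.
  have p0 : 0 < pr (fun x => (f x, g x)) (a, b) by rewrite lt0r n0 pr_ge0.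
  by rewrite lnM ?posrE ?mulrDr // (lt_le_trans p0).
apply: gibbs => [c|[a b]||[a b] /= /eqP].
- exact: pr_ge0.
- by rewrite mulr_ge0 ?pr_ge0.
- rewrite sum_pr // -(pair_bigA _ (fun a b => pr f a * pr g b)) /=.
  by under eq_bigr do rewrite -mulr_sumr sum_pr // mulr1; rewrite sum_pr.
- rewrite mulf_eq0 => /orP [] /eqP p0; apply/eqP; rewrite eq_le pr_ge0 andbT.
    by rewrite -p0.
  by rewrite -p0.
Qed.

Lemma partition_ffun {I L : finType} {A : I -> X -> L} :
  (forall i, is_partition (A i)) -> is_partition (fun x => [ffun i => A i x]).
Proof.
move=> mA b; rewrite (_ : _ @^-1` _ = \bigcap_i A i @^-1` [set b i]).
  by apply: fin_bigcap_measurable => [|i _]; [exact: finite_finset|exact: mA].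
apply/seteqP; split => x /=; first by move=> <- i _ /=; rewrite ffunE.
by move=> bx; apply/ffunP => i; rewrite ffunE bx.
Qed.

Lemma entropy_ffun {L : finType} {N : nat} {A : nat -> X -> L} {c : R} :
  (forall i, is_partition (A i)) -> (forall i, entropy mu (A i) <= c) ->
  entropy mu (fun x => [ffun i : 'I_N => A i x]) <= N%:R * c.
Proof.
move=> mA Ac; elim: N => [|N IH].
  apply: le_trans (entropy_le_card (partition_ffun (fun i : 'I_0 => mA i))) _.
  by rewrite card_ffun card_ord expn0 ln1 mul0r.
have := entropy_pair (partition_ffun (fun i : 'I_N => mA i)) (mA N).
move=> /le_trans => /(_ _ (lerD IH (Ac N))); rewrite -natr1 mulrDl mul1r.
apply: le_trans; apply: entropy_determined.
- exact: partition_ffun.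
- by apply: partition_pair => //; apply: partition_ffun.
move=> x y [/ffunP e1 e2]; apply/ffunP => i; rewrite !ffunE.
have := ltn_ord i; rewrite ltnS leq_eqVlt => /orP [/eqP -> //|iN].
by have := e1 (Ordinal iN); rewrite !ffunE.
Qed.

(** With [s = Num.sqrt x] the left side is [2 * s ^+ 2 * ln (s^-1)], and [ln (s^-1) <= s^-1]. *)
Lemma xlnx_le_sqrt {x : R} : 0 <= x -> - (x * ln x) <= 2 * Num.sqrt x.
Proof.
move=> x0; have [->|xn0] := eqVneq x 0; first by rewrite mul0r oppr0 sqrtr0 mulr0.
have s0 : 0 < Num.sqrt x by rewrite sqrtr_gt0 lt0r xn0.
rewrite -{1 2}(sqr_sqrtr x0) lnXn //.
have : - ln (Num.sqrt x) <= (Num.sqrt x)^-1.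
  rewrite -lnV ?posrE //; apply: ltW; apply: ln_sublinear.
  by rewrite invr_gt0.
move: s0; set s := Num.sqrt x => s0 le.
have := ler_wpM2l (ltW s0) le; rewrite divff ?gt_eqF // => /(ler_wpM2l (ltW s0)).
by rewrite mulr2n; nra.
Qed.

(** The large atom, of mass [p], contributes [- p ln p <= 1 - p <= e]; each of the others has mass
    at most [e] and contributes at most [2 * Num.sqrt e]. *)
Lemma entropy_concentrated {L : finType} {P : X -> option L} {e : R} :
  is_partition P -> fine (mu (~` (P @^-1` [set None]))) <= e ->
  entropy mu P <= e + #|L|%:R * (2 * Num.sqrt e).
Proof.
move=> mP le; rewrite /entropy.
have e0 : 0 <= e by apply: le_trans le; apply: fine_ge0.
have prN : pr P None = 1 - fine (mu (~` (P @^-1` [set None]))).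
  rewrite probability_setC // fineB ?fin_mu //=; ring.
rewrite (bigD1 None) //= opprD; apply: lerD.
  set p := pr P None in prN *; have p1 : 1 - p <= e by rewrite prN; lra.
  have [p0|p0] := eqVneq p 0; first by rewrite p0 mul0r oppr0.
  have pp : 0 < p by rewrite lt0r p0 pr_ge0.
  apply: le_trans p1; rewrite -mulrN -lnV ?posrE //.
  have /ln_le_sub1/(ler_wpM2l (ltW pp)) : 0 < p^-1 by rewrite invr_gt0.
  by rewrite mulrBr divff // mulr1.
rewrite -sumrN (reindex_omap Some id) => [|[]//] /=.
rewrite (eq_bigl xpredT) => [|a]; last by rewrite eqxx.
rewrite mulr_natl -sumr_const; apply: ler_sum => a _.
apply: le_trans (xlnx_le_sqrt (pr_ge0 _ _ _)) _.
rewrite ler_wpM2l // ler_wsqrtr //; apply: le_trans le.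
by apply: le_fine_mu => //; [apply: measurableC|move=> x /= ->].
Qed.

End Entropy.

(** * Counting in rectangles *)

Section Rectangles.
Context {d : nat}.
Implicit Types (S : {fset 'rV[int]_d}) (m n : 'rV[int]_d).

Lemma card_rectangle {S m n} {N : nat} :
  (forall v, v \in S = [forall i, m 0 i <= v 0 i <= n 0 i]) ->
  (forall i, (`|(n 0 i - m 0 i)%R| < N)%N) -> (#|` S| <= N ^ d)%N.
Proof.
(* [N = 0] is possible only for [d = 0], where [S] is the single point [0] and [0 ^ 0 = 1]. *)
move=> Smn; case: N => [|N] ltN.
  case: d S m n Smn ltN => [|d'] S m n Smn ltN; last by have := ltN ord0.
  rewrite expn0 (_ : S = fset1 0) ?cardfs1 //; apply/fsetP => v.
  by rewrite in_fset1 Smn (thinmx0 v) eqxx; apply/forallP => -[].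
rewrite cardfE.
pose h (v : S) : {ffun 'I_d -> 'I_N.+1} :=
  [ffun j => inord `|((val v) 0 j - m 0 j)%R|%N].
have hinj : injective h.
  move=> u v /ffunP huv; apply: val_inj; apply/rowP => j.
  have := huv j; rewrite !ffunE.
  have := valP u; have := valP v; rewrite !Smn => /forallP /(_ j) vj.
  move=> /forallP /(_ j) uj; have ltj := ltN j.
  move=> /(congr1 val); rewrite /= !inordK; move: uj vj ltj => /=; lia.
by have := leq_card h hinj; rewrite card_ffun !card_ord.
Qed.

Lemma corner_notin_translate {S m n} i :
  (forall v, v \in S = [forall i, m 0 i <= v 0 i <= n 0 i]) ->
  m \notin translate S (delta_mx 0 i).
Proof.
move=> Smn; apply/negP => /imfsetP [v /=]; rewrite Smn => /forallP /(_ i).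
move=> le /rowP /(_ i); rewrite !mxE !eqxx mulr1n => E.
by move: le; rewrite E gerDl.
Qed.

End Rectangles.

(** * Tower labels along orbits, and entropy of blocks *)

Section Dynamics.
Context {R : realType} {disp : measure_display} {X : measurableType disp}.
Context {mu : probability X R} {d : nat} {T : 'rV[int]_d -> X -> X}.

Section Towers.
Hypothesis act0 : forall x, T 0 x = x.
Hypothesis actM : forall v w x, T (v + w) x = T v (T w x).
Context {S : {fset 'rV[int]_d}} {B : set X} {P : X -> option S}.
Hypothesis PB : is_tower mu T B P.

(** A point labeled [u] is [T u b] with [b] in the base, so [T w] takes it to [T (u + w) b].
    Applying [omap val] lets labels be added as vectors. *)
Lemma tower_shift {x u} w : u + w \in S ->
  omap val (P x) = Some u -> omap val (P (T w x)) = Some (u + w).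
Proof.
move=> uwS; have [_ _ _ PS _] := PB.
case Px : (P x) => [v|] //= [vu]; subst u.
have : (P @^-1` [set Some v]) x by [].
rewrite PS => -[b Bb xb].
suff : (P @^-1` [set Some [` uwS]%fset]) (T w x) by move=> /= ->.
by rewrite PS; exists b; rewrite // -xb -actM [w + _]addrC.
Qed.

Context {m n : 'rV[int]_d} {i : 'I_d}.
Hypothesis Smn : forall v, v \in S = [forall i, m 0 i <= v 0 i <= n 0 i].

Let e := delta_mx 0 i : 'rV[int]_d.

Let rectangle_shift {u : 'rV[int]_d} {a : int} : u \in S ->
  m 0 i <= u 0 i + a <= n 0 i -> u + a *: e \in S.
Proof.
rewrite !Smn => /forallP uS le; apply/forallP => j; rewrite !mxE /=.
have [->|ji] := eqVneq j i; first by rewrite mulr1.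
by rewrite mulr0 addr0.
Qed.

Let shiftM a b x : T (a *: e) (T (b *: e) x) = T ((b + a) *: e) x.
Proof. by rewrite -actM -scalerDl addrC. Qed.

(* A maximal run of labels in S has length n_i - m_i + 1, so a run meeting a
   window of that length contains one of its two ends. *)
Lemma tower_block {x y} {r : int} : 0 <= r <= n 0 i - m 0 i -> P x = P y ->
  P (T ((n 0 i - m 0 i) *: e) x) = P (T ((n 0 i - m 0 i) *: e) y) ->
  P (T (r *: e) x) = P (T (r *: e) y).
Proof.
set l := n 0 i - m 0 i => rl.
(* By symmetry it is enough to carry a label in [S] from one point to the other; the error label
   then agrees as well. *)
suff half x' y' u : P x' = P y' -> P (T (l *: e) x') = P (T (l *: e) y') ->
    omap val (P (T (r *: e) x')) = Some u ->
    omap val (P (T (r *: e) y')) = Some u.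
  move=> Pxy Plxy; apply: (@inj_omap _ _ val val_inj).
  case Ex : (omap val (P (T (r *: e) x))) => [u|]; first by rewrite (half x y u).
  case Ey : (omap val (P (T (r *: e) y))) => [u|//].
  by rewrite (half y x u) in Ex.
move=> Pxy Plxy Pu.
have uS : u \in S by move: Pu; case: (P _) => //= v [<-]; apply: valP.
have /forallP /(_ i) ui : [forall i, m 0 i <= u 0 i <= n 0 i] by rewrite -Smn.
(* If going back [r] steps leaves the rectangle, then going forward [l - r] steps does not, and the
   far end of the window decides the label; otherwise the near end does. *)
have [lt|ge] := ltP (u 0 i - r) (m 0 i).
  have uS' : u + (l - r) *: e \in S.
    apply: rectangle_shift => //; move: rl lt ui; rewrite /l;
    by move: (u 0 i) (m 0 i) (n 0 i) => p q s; lia.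
  have := tower_shift _ uS' Pu; rewrite shiftM subrKC Plxy.
  move=> /(tower_shift ((r - l) *: e)); rewrite shiftM subrKC.
  by rewrite -addrA -scalerDl addrC subrKA subrr scale0r add0r; apply.
have uS' : u + (- r) *: e \in S.
  apply: rectangle_shift => //; move: rl ge ui; rewrite /l;
  by move: (u 0 i) (m 0 i) (n 0 i) => p q s; lia.
have := tower_shift _ uS' Pu; rewrite shiftM subrr scale0r act0 Pxy.
move=> /(tower_shift (r *: e)); rewrite -addrA -scalerDl addNr scale0r addr0.
exact.
Qed.

End Towers.

Hypothesis act : free_mp_action mu T.

Lemma is_partition_shift {L : finType} {P : X -> L} w :
  is_partition P -> is_partition (P \o T w).
Proof.
case: act => _ mT _ _ mP a; rewrite comp_preimage -[X in measurable X]setTI.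
exact: mT.
Qed.

Lemma entropy_shift {L : finType} {P : X -> L} w :
  is_partition P -> entropy mu (P \o T w) = entropy mu P.
Proof.
case: act => _ _ muT _ mP; rewrite /entropy; congr (- _); apply: eq_bigr => a _.
by rewrite comp_preimage muT.
Qed.

Lemma is_partition_tower {S : {fset 'rV[int]_d}} {B} {P : X -> option S} :
  is_tower mu T B P -> is_partition P.
Proof.
case: act => -[T0 TD] mT _ _ [mB _ _ PS _].
have mTB v : measurable (T v @` B).
  rewrite (_ : _ @` _ = T (- v) @^-1` B); last first.
    apply/seteqP; split=> [_ [b Bb <-]|x Bx] /=; first by rewrite -TD addNr T0.
    by exists (T (- v) x); rewrite // -TD subrr T0.
  by rewrite -[X in measurable X]setTI; apply: mT.
have mS v : measurable (P @^-1` [set Some v]) by rewrite PS.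
case=> [v|] //; rewrite (_ : _ @^-1` _ = ~` \bigcup_v P @^-1` [set Some v]).
  apply: measurableC; apply: fin_bigcup_measurable => //; exact: finite_finset.
apply/seteqP; split => x /=; first by move=> Px [v _] /=; rewrite Px.
by move=> nP; case E: (P x) => [v|] //; case: nP; exists v.
Qed.

(** The [N] times are cut into blocks of [l.+1]. The values of [P] at the two ends of a block give
    [P] throughout it, at a cost of at most [2 * ln #|M|] per block; adding [D] at every time
    recovers [Q]. *)
Lemma entropy_block {L M : finType} {Q : X -> L} {P : X -> M} {D : X -> option L}
    {e : 'rV[int]_d} {l : nat} {a : int} {N : nat} :
  is_partition Q -> is_partition P -> is_partition D ->
  (forall x y, P x = P y -> D x = D y -> Q x = Q y) ->
  (forall x y (r : nat), (r <= l)%N -> P x = P y ->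
     P (T (l%:Z *: e) x) = P (T (l%:Z *: e) y) ->
     P (T (r%:Z *: e) x) = P (T (r%:Z *: e) y)) ->
  entropy mu (action_join T (fun j : 'I_N => (a + j%:Z) *: e) Q) <=
    (N %/ l.+1).+1%:R * (2 * ln #|M|%:R) + N%:R * entropy mu D.
Proof.
move=> mQ mP mD PDQ block; have [[_ TD] _ _ _] := act.
(* The extra block covers an incomplete last one; its far end may lie beyond time [N]. *)
set K := (N %/ l.+1).+1.
pose t b := (a + (b * l.+1)%N%:Z) *: e.
pose E (b : nat) x := (P (T (t b) x), P (T (l%:Z *: e) (T (t b) x))).
pose E' (x : X) := [ffun b : 'I_K => E b x].
pose D' x := [ffun j : 'I_N => D (T ((a + j%:Z) *: e) x)].
have mE' : is_partition E'.
  apply: (partition_ffun (A := fun b : 'I_K => E b)) => b.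
  apply: partition_pair; first exact: (is_partition_shift (t b) mP).
  exact: (is_partition_shift (t b) (is_partition_shift (l%:Z *: e) mP)).
have mD' : is_partition D'.
  by apply: partition_ffun => j; apply: (is_partition_shift _ mD).
have HE : entropy mu E' <= K%:R * (2 * ln #|M|%:R).
  apply: (le_trans (entropy_le_card mu mE')).
  have M0 : (0 < #|{: M}|)%N by apply/card_gt0P; exists (P point).
  rewrite card_ffun card_prod card_ord natrX natrM lnXn ?mulr_gt0 ?ltr0n //.
  by rewrite lnM ?posrE ?ltr0n // mulr_natl [2 * _]mulr_natl mulr2n.
have HD : entropy mu D' <= N%:R * entropy mu D.
  apply: (@entropy_ffun _ _ _ _ _ N (fun j x => D (T ((a + j%:Z) *: e) x))) => j.
    exact: (is_partition_shift _ mD).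
  by rewrite (entropy_shift _ mD).
apply: le_trans (lerD HE HD); apply: le_trans (entropy_pair mu mE' mD').
apply: entropy_determined.
- by apply: partition_ffun => j; apply: (is_partition_shift _ mQ).
- exact: partition_pair.
move=> x y [/ffunP EE /ffunP DD]; apply/ffunP => j; rewrite !ffunE.
apply: PDQ; last by have := DD j; rewrite !ffunE.
have jK : (j %/ l.+1 < K)%N by rewrite ltnS leq_div2r // ltnW.
have := EE (Ordinal jK); rewrite !ffunE /= => -[E1 E2].
have -> : (a + j%:Z) *: e = (j %% l.+1)%N%:Z *: e + t (j %/ l.+1)%N.
  by rewrite /t -scalerDl {1}(divn_eq j l.+1); congr (_ *: _); lia.
by rewrite !TD; apply: block => //; rewrite -ltnS ltn_mod.
Qed.

End Dynamics.

(** * Numerical estimates *)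

Section Estimates.
Context {R : realType}.

Lemma sqrt_concentration_small {N : nat} {eps : R} : 0 < eps ->
  exists2 delta : R, 0 < delta & delta + N%:R * (2 * Num.sqrt delta) <= eps.
Proof.
move=> e0; have N0 : 0 <= N%:R :> R by [].
have D0 : 0 < eps + (1 + 2 * N%:R) by lra.
(* With [delta = eta ^+ 2] and [eta <= 1], the sum is at most [eta * (1 + 2 * N%:R)], hence at most
   [eps]. *)
pose eta := eps / (eps + (1 + 2 * N%:R)).
have eta0 : 0 < eta by rewrite divr_gt0.
have eta1 : eta <= 1 by rewrite ler_pdivrMr // mul1r; lra.
have etaE : eta * (1 + 2 * N%:R) <= eps.
  by rewrite mulrAC ler_pdivrMr // ler_pM2l //; lra.
exists (eta ^+ 2); first by rewrite exprn_gt0.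
rewrite sqrtr_sqr gtr0_norm //; apply: le_trans etaE.
by rewrite expr2; nra.
Qed.

Lemma ln_card_small {d : nat} {eps : R} : (0 < d)%N -> 0 < eps ->
  exists s0 : nat, forall s c : nat, (s0 <= s)%N -> (c <= s ^ d)%N ->
    2 * ln (c.+1%:R) <= eps * s%:R.
Proof.
(* Put [q = Num.sqrt (2 * s)]. From [c.+1 <= (2 * s) ^ d] and [ln q <= q] the left side is at most
   [4 d q], and [q >= 8 d / eps] bounds this by [eps * q ^+ 2 / 2 = eps * s]. *)
move=> d0 e0; pose z := (8 * d%:R / eps) ^+ 2.
exists (Num.Def.archi_bound z).+1 => s c s0s cs.
have s_gt0 : (0 < s)%N by exact: leq_trans s0s.
have zs : z <= (2 * s)%:R.
  have /ltW /le_trans := archi_boundP (sqr_ge0 _ : 0 <= z); apply.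
  by rewrite ler_nat (leq_trans (ltnW s0s)) // leq_pmull.
set q := Num.sqrt (2 * s)%:R : R.
have q2 : q ^+ 2 = (2 * s)%:R by rewrite sqr_sqrtr.
have q0 : 0 < q by rewrite sqrtr_gt0 ltr0n muln_gt0.
have qz : 8 * d%:R / eps <= q.
  by rewrite -(@ler_pXn2r _ 2) ?nnegrE ?q2 ?(ltW q0) // divr_ge0 ?mulr_ge0 ?(ltW e0).
have : ln (c.+1%:R : R) <= d%:R * (2 * q).
  have : ln (c.+1%:R : R) <= ln ((2 * s)%:R ^+ d).
    rewrite ler_ln ?posrE ?exprn_gt0 ?ltr0n ?muln_gt0 // -natrX ler_nat.
    rewrite expnMn; apply: (@leq_trans (2 * s ^ d)).
      by rewrite mul2n -addnn -addn1 leq_add // expn_gt0 s_gt0.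
    by rewrite leq_mul2r -{1}(expn1 2) leq_pexp2l ?orbT.
  move=> /le_trans; apply; rewrite lnXn ?ltr0n ?muln_gt0 //.
  rewrite -[leLHS]mulr_natl ler_wpM2l // -q2 lnXn //.
  by rewrite -[leLHS]mulr_natl ler_wpM2l // ltW // ln_sublinear.
have : 8 * d%:R <= eps * q by move: qz; rewrite ler_pdivrMr // [q * _]mulrC.
move: q2; rewrite natrM => q2.
have -> : eps * q = eps * (2 * s%:R) / q by rewrite -q2 expr2 mulrA mulfK ?gt_eqF.
rewrite ler_pdivlMr // => le1 le2; lra.
Qed.

End Estimates.

(** * Pigeonhole, and growth of Folner rectangles *)

Lemma infinitely_often {I : finType} (f : nat -> I) :
  exists i, forall K, exists2 k, (K <= k)%N & f k = i.
Proof.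
apply: contrapT => /forallNP nf.
have /choice [K HK] i : exists K, forall k, (K <= k)%N -> f k <> i.
  have /existsNP [K nK] := nf i; exists K => k Kk fk.
  by apply: nK; exists k.
(* At an index beyond all the thresholds [f] has no value left. *)
apply: (HK (f (\max_i K i)%N) (\max_i K i)%N) => //.
exact: leq_bigmax.
Qed.

(** A unit translate misses the lowest corner, so the Folner ratio is at least the inverse of the
    cardinality; as the ratio tends to [0], the cardinality is unbounded. *)
Lemma folner_card {R : realType} {d : nat} {Rk : nat -> {fset 'rV[int]_d}}
    (M : nat) :
  (0 < d)%N -> (forall k, is_rectangle (Rk k)) -> folner R Rk ->
  \forall k \near \oo, (M < #|` Rk k|)%N.
Proof.
move=> d0 rect [Rk0 fol]; pose i := Ordinal d0.
have M0 : 0 < (M.+1%:R : R)^-1 by rewrite invr_gt0.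
have /cvgr_lt /(_ _ M0) := fol (delta_mx 0 i); apply: filterS => k.
have [m [n [mn Smn]]] := rect k.
have c0 : (0 < #|` Rk k|)%N by rewrite cardfs_gt0.
set A := (_ `|` _)%fset => ltA.
have A0 : (0 < #|` A|)%N.
  rewrite cardfs_gt0; apply/fset0Pn; exists m; rewrite in_fsetU !in_fsetD.
  rewrite (corner_notin_translate i Smn) Smn.
  by apply/orP; left; apply/forallP => j; rewrite lexx mn.
have : (#|` Rk k|%:R : R)^-1 < (M.+1%:R)^-1.
  apply: le_lt_trans ltA; rewrite -[leLHS]mul1r ler_wpM2r ?invr_ge0 //.
  by rewrite ler1n.
by rewrite ltf_pV2 ?posrE ?ltr0n // ltr_nat => /ltnW.
Qed.

(** * Approximation by towers, and entropy along one axis *)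

Section Approximation.
Context {R : realType} {disp : measure_display} {X : measurableType disp}.
Context {mu : probability X R}.

(** Each atom of [Q] is close to a union [U] of atoms of [P k]. Off the union [EE] of the finitely
    many errors, [P k] determines [Q]; on [EE] the label [D] gives [Q] itself. *)
Lemma error_label {Lk : nat -> finType} {P : forall k, X -> Lk k}
    {L : finType} {Q : X -> L} {delta : R} :
  (forall k, is_partition (P k)) -> cvg_to_points mu P -> is_partition Q ->
  0 < delta ->
  \forall k \near \oo, exists D : X -> option L,
    [/\ is_partition D, fine (mu (~` (D @^-1` [set None]))) <= delta &
        forall x y, P k x = P k y -> D x = D y -> Q x = Q y].
Proof.
move=> mP cvgP mQ delta0.
have /choice [I HI] a := cvgP _ (mQ a).
pose U a k := \bigcup_(b in [set` I a k]) (P k @^-1` [set b]).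
pose E a k := U a k `+` Q @^-1` [set a].
have mU a k : measurable (U a k).
  by apply: fin_bigcup_measurable => [|b _]; [exact: finite_finset|exact: mP].
have mE a k : measurable (E a k).
  by apply: measurableU; apply: measurableD.
pose EE k := \bigcup_(a in [set` enum L]) E a k.
have mEE k : measurable (EE k) by apply: fin_bigcup_measurable.
have cvgE : (fun k => \sum_(a <- enum L) mu (E a k))%E @ \oo --> 0%E.
  have : (fun k => \sum_(a <- enum L) mu (E a k))%E @ \oo -->
         (\sum_(a <- enum L) (0%R : R)%:E)%E.
    apply: cvg_nnesum => a _; last exact: HI.
    by apply: nearW => k; apply: measure_ge0.
  by rewrite big1.
have /fine_cvgP [_ /cvgr_lt /(_ _ delta0)] := cvgE.
apply: filterS => k /= small.
pose D x := if `[< EE k x >] then Some (Q x) else None.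
have DN : D @^-1` [set None] = ~` EE k.
  apply/seteqP; split => x; rewrite /= /D; first by case: asboolP.
  by move=> nE; rewrite asboolF.
exists D; split.
- case=> [a|]; last by rewrite DN; apply: measurableC.
  rewrite (_ : _ @^-1` _ = EE k `&` Q @^-1` [set a]); first exact: measurableI.
  apply/seteqP; split => x; rewrite /= /D; first by case: asboolP => // ? [].
  by case=> Ex ->; rewrite asboolT.
- rewrite DN setCK; apply: le_trans (ltW small).
  have finE : (\sum_(a <- enum L) mu (E a k))%E \is a fin_num.
    by rewrite sum_fin_num; apply/allP => _ /mapP [a _ ->]; apply: fin_mu.
  rewrite fine_le ?fin_mu //.
  rewrite fsbig_seq ?enum_uniq //.
  by apply: content_sub_fsum.
- move=> x y Pxy; rewrite /D; case: asboolP => Ex; case: asboolP => Ey // e.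
    by case: e.
  (* Both points are now outside [EE]: [x] lies in [U (Q x) k], hence so does [y], which has the
     same [P k] label, and then [Q y = Q x]. *)
  have Ux : U (Q x) k x.
    apply: contrapT => nU; apply: Ex; exists (Q x); first by rewrite /= mem_enum.
    by right; split.
  have Uy : U (Q x) k y by case: Ux => b Ib /= Pb; exists b => //=; rewrite -Pxy.
  apply: contrapT => nQ; apply: Ey; exists (Q x); first by rewrite /= mem_enum.
  by left; split => //= e'; apply: nQ.
Qed.

End Approximation.

(** The constant is uniform in the starting point [a], so that windows extending to both sides of
    the origin can be treated. *)
Lemma linear_entropy {R : realType} {disp : measure_display}
    {X : measurableType disp} {mu : probability X R} {d : nat}
    {T : 'rV[int]_d -> X -> X} :
  (0 < d)%N -> rectangular_rank_one mu T ->
  exists i : 'I_d, forall (L : finType) (Q : X -> L), is_partition Q ->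
  forall eps : R, 0 < eps -> exists C : R, forall (a : int) (N : nat),
    entropy mu (action_join T
      (fun j : 'I_N => (a + j%:Z) *: (delta_mx 0 i : 'rV[int]_d)) Q)
      <= eps * N%:R + C.
Proof.
move=> d0 [Rk [rect fol [act [P [towP cvgP]]]]].
have [[T0 TD] _ _ _] := act.
have /choice [m /choice [n mn]] := rect.
pose s k j := (`|(n k 0 j - m k 0 j)%R|%N).+1.
pose big k := [arg max_(j > Ordinal d0) s k j].
have [i ioft] := infinitely_often big; exists i => L Q mQ eps eps0.
have mP k : is_partition (P k).
  by have [B /(is_partition_tower act)] := towP k.
(* One half of [eps] pays for the error label [D], the other for the labels at the ends of
   blocks. *)
have eps2 : 0 < eps / 2 by rewrite divr_gt0.
have [delta delta0 deltaP] := @sqrt_concentration_small R #|L| _ eps2.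
have [s0 s0P] := @ln_card_small R d _ d0 eps2.
have := filterI (error_label mP cvgP mQ delta0) (folner_card (s0 ^ d) d0 rect fol).
move=> [K _ HK]; have [k Kk bigk] := ioft K.
have [[D [mD Dsmall PDQ]] /= card_gt] := HK k Kk.
have [le_mn Smn] := mn k.
have smax j : (s k j <= s k i)%N.
  by rewrite -bigk /big; case: arg_maxnP => // j' _ /(_ j isT).
have card_le : (#|` Rk k| <= s k i ^ d)%N by apply: card_rectangle Smn _.
(* A longest side shorter than [s0] would leave at most [s0 ^ d] points in the rectangle. *)
have s0s : (s0 <= s k i)%N.
  rewrite leqNgt; apply/negP => /ltnW lt; move: card_gt.
  by rewrite ltnNge (leq_trans card_le) // leq_exp2r.
have := s0P _ _ s0s card_le.
have sE : (s k i).-1%:Z = n k 0 i - m k 0 i.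
  by rewrite /s /= gez0_abs // subr_ge0.
rewrite cardfE -card_option; set A := 2 * _ => A_le.
have HD : entropy mu D <= eps / 2.
  by apply: le_trans deltaP; apply: entropy_concentrated.
(* [A] is the cost of the one block in excess of [N %/ s k i]. *)
exists A => a N; have [B towB] := towP k.
apply: le_trans (entropy_block (l := (s k i).-1) act mQ (mP k) mD PDQ _) _.
  move=> x y r rl Pxy; rewrite sE.
  by apply: (tower_block T0 TD towB Smn) => //; rewrite -sE /= lez_nat.
rewrite [(s k i).-1.+1]prednK // -/A -natr1.
have : (N %/ s k i)%:R * (s k i)%:R <= N%:R :> R.
  by rewrite -natrM ler_nat leq_divM.
have : 0 <= (N %/ s k i)%:R :> R by [].
have : 0 <= N%:R :> R by [].
set x := (N %/ s k i)%:R; set y := N%:R; set z := (s k i)%:R in A_le *.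
move=> y0 x0 xzy.
have := ler_wpM2l x0 A_le; have := ler_wpM2l y0 HD.
have := ler_wpM2l (ltW eps2) xzy; lra.
Qed.

(** * Upper limits of sublinear quantities *)

Section Rates.
Context {R : realType}.

(** Nonemptiness matters: the supremum of the empty set is [-oo]. *)
Lemma ereal_sup_eq0 {S : set (\bar R)} :
  S !=set0 -> (forall x, S x -> x = 0%E) -> ereal_sup S = 0%E.
Proof.
move=> [x Sx] S0; rewrite (_ : S = [set 0%E]) ?ereal_sup1 //.
by apply/seteqP; split => [y /S0 //|y ->]; rewrite -(S0 _ Sx).
Qed.

(** Stated for a general filter and scale [tau], to serve both integer times and real window
    lengths. *)
Lemma limf_esup_sublinear {T : choiceType} {Y : filteredType T}
    {F : set_system Y} {FF : ProperFilter F} {tau h : Y -> R} :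
  (forall M, \forall x \near F, M <= tau x) -> (forall x, 0 <= h x) ->
  (forall eps, 0 < eps ->
     exists C, forall x, 0 < tau x -> h x <= eps * tau x + C) ->
  limf_esup (fun x => ((tau x)^-1 * h x)%:E) F = 0%E.
Proof.
move=> tauy h0 hle; apply/eqP; rewrite eq_le; apply/andP; split.
  apply/lee_addgt0Pr => eps eps0; rewrite add0e.
  have e2 : 0 < eps / 2 by rewrite divr_gt0.
  have [C HC] := hle _ e2.
  (* Beyond this threshold [tau x] is positive and [C] is at most [eps / 2 * tau x]. *)
  apply: (@le_trans _ _ (ereal_sup [set ((tau x)^-1 * h x)%:E | x in
    [set x | 1 + `|C| * 2 / eps <= tau x]])).
    apply: ereal_inf_lbound; exists [set x | 1 + `|C| * 2 / eps <= tau x] => //.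
    exact: tauy.
  apply: ub_ereal_sup => _ [x /= taux <-]; rewrite lee_fin.
  have C0 : 0 <= `|C| * 2 / eps by rewrite divr_ge0 ?mulr_ge0 // ltW.
  have tau0 : 0 < tau x by lra.
  rewrite ler_pdivrMl //; apply: le_trans (HC _ tau0) _.
  have : `|C| * 2 / eps <= tau x by lra.
  by rewrite ler_pdivrMr // => le; have := ler_norm C; lra.
apply: le_ereal_inf_tmp => _ [V FV <-].
have [x [Vx tau1]] := filter_ex (filterI FV (tauy 1)).
apply: (@le_trans _ _ ((tau x)^-1 * h x)%:E).
  by rewrite lee_fin mulr_ge0 // invr_ge0 (le_trans _ tau1).
by apply: ereal_sup_ubound; exists x.
Qed.

End Rates.

(** * Lattice points of windows along a coordinate axis *)

Section Windows.
Context {R : realType} {d : nat} {i : 'I_d}.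
Variables (v : 'rV[R]_d) (U : 'M[R]_(d.-1, d)).

(* [fset_set] of an infinite set is empty. *)
Lemma window_pointsP {t m : R} {w} :
  w \in window_points v U t m -> window v U t m (map_mx intr w).
Proof.
rewrite /window_points; set A := [set w | _].
have [fA|iA] := pselect (finite_set A).
  by rewrite in_fset_set // inE.
by rewrite /fset_set; case: pselect.
Qed.

Hypothesis v_axis : forall j, j != i -> v 0 j = 0.
Hypothesis U_axis : forall k, U k i = 0.

(** The rows of [U] vanish at [i], so this coordinate comes from [v] alone, with a coefficient
    between [0] and [t]. *)
Lemma window_axis {t m : R} {w} : 0 < t -> w \in window_points v U t m ->
  (`|w 0%R i| <= Num.truncn (t * `|v 0 i|)%R)%N.
Proof.
move=> t0 /window_pointsP [_ [c1 c1P <-] [_ [c2 c2P <-]]] /rowP /(_ i).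
rewrite !mxE big_ord1 [X in _ + m * X]big1 => [|k _]; last first.
  by rewrite U_axis mulr0.
rewrite mulr0 addr0 => E; rewrite truncn_ge_nat; last first.
  by rewrite mulr_ge0 // ltW.
rewrite natr_absz intr_norm -E !normrM gtr0_norm // ler_pM2l //.
have /andP [c10 c11] := c1P 0.
by rewrite ger0_norm // ler_piMl.
Qed.

(** A crude bound, common to all coordinates other than [i] and independent of [t]: the window stays
    in a tube of fixed width. *)
Definition cross_radius (m : R) : nat :=
  Num.truncn (m * \sum_j \sum_k `|U k j|).

Lemma window_cross {t m : R} {w} j : 0 < m -> w \in window_points v U t m ->
  j != i -> (`|w 0%R j| <= cross_radius m)%N.
Proof.
move=> m0 /window_pointsP [_ [c1 c1P <-] [_ [c2 c2P <-]]] /rowP /(_ j) + ji.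
rewrite !mxE big_ord1 v_axis // !mulr0 add0r => E.
have S0 j' : 0 <= \sum_k `|U k j'| by apply: sumr_ge0.
rewrite truncn_ge_nat; last by rewrite mulr_ge0 ?(ltW m0) ?sumr_ge0.
rewrite natr_absz intr_norm -E !normrM gtr0_norm // ler_pM2l //.
apply: le_trans (ler_norm_sum _ _ _) _.
rewrite (bigD1 j) //=; apply: ler_wpDr; first exact: sumr_ge0.
apply: ler_sum => k _; rewrite normrM ler_piMl //.
by have := c2P k; rewrite ler_norml => /andP [? ?]; apply/andP; split; lra.
Qed.

End Windows.

(** * Vanishing of the entropy in the direction of the axis *)

Section DirectionalEntropy.
Context {R : realType} {disp : measure_display} {X : measurableType disp}.
Context {mu : probability X R} {d : nat} {T : 'rV[int]_d -> X -> X}.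
Hypothesis act : free_mp_action mu T.

Lemma is_partition_join {I L : finType} {w : I -> 'rV[int]_d} {P : X -> L} :
  is_partition P -> is_partition (action_join T w P).
Proof.
by move=> mP; apply: partition_ffun => j; apply: (is_partition_shift act _ mP).
Qed.

Variable i : 'I_d.
Let e := delta_mx 0 i : 'rV[int]_d.
Hypothesis axis_entropy : forall (L : finType) (Q : X -> L), is_partition Q ->
  forall eps : R, 0 < eps -> exists C : R, forall (a : int) (N : nat),
    entropy mu (action_join T (fun j : 'I_N => (a + j%:Z) *: e) Q)
      <= eps * N%:R + C.

Let sup_eq0 (F : forall L : finType, (X -> L) -> \bar R) :
  (forall (L : finType) (P : X -> L), is_partition P -> F L P = 0%E) ->
  ereal_sup [set h | exists (L : finType) (P : X -> L),
                       is_partition P /\ h = F L P] = 0%E.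
Proof.
move=> F0; apply: ereal_sup_eq0 => [|_ [L [P [mP ->]]]]; last exact: F0.
(* The one-atom partition makes the set nonempty. *)
exists (F unit (fun=> tt)), unit, (fun=> tt); split => // -[].
by rewrite (_ : _ @^-1` _ = setT) //; apply/seteqP.
Qed.

Lemma ks_entropy_eq0 : d = 1%N -> ks_entropy mu T = 0%E.
Proof.
move=> d1; apply: sup_eq0 => L P mP.
apply: limf_esup_sublinear => [M|n|eps eps0].
- exact: nbhs_infty_ger.
- by apply: entropy_ge0; apply: is_partition_join.
- have [C HC] := axis_entropy _ _ mP _ eps0; exists C => n _.
  rewrite (_ : (fun j : 'I_n => _) = (fun j : 'I_n => (0 + j%:Z) *: e)) //.
  apply/funext => j; apply/rowP => k; rewrite !mxE add0r.
  rewrite (_ : k = i) ?eqxx ?mulr1 //.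
  by apply: val_inj => /=; have := ltn_ord k; have := ltn_ord i; lia.
Qed.

(** The window lies in a tube around the axis. The join of [P] over a cross section of the tube is
    one finite partition, independent of [t], to which [axis_entropy] applies. *)
Lemma dir_entropy_eq0 (v : 'rV[R]_d) (U : 'M[R]_(d.-1, d)) :
  (forall j, j != i -> v 0 j = 0) -> (forall k, U k i = 0) ->
  dir_entropy mu T v U = 0%E.
Proof.
move=> v_axis U_axis; apply: sup_eq0 => L P mP.
apply: ereal_sup_eq0 => [|_ [m m0 <-]].
  by exists (dir_entropy_width mu T v U P 1), 1 => //=.
apply: (limf_esup_sublinear (tau := id)) => [M|t|eps eps0].
- exact: nbhs_pinfty_ge (num_real _).
- by apply: entropy_ge0; apply: is_partition_join.
have [[_ TD] _ _ _] := act.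
set r := cross_radius U m.
pose box (b : {ffun 'I_d -> 'I_(r + r).+1}) : 'rV[int]_d :=
  \row_j (if j == i then 0 else (b j)%:Z - r%:Z).
(* The tube has [2 K + 1] cross sections with [K <= t * |v_i|], so the rate [eps / c] yields at most
   [eps * t + eps / c]. The summand [1] keeps [c] positive. *)
pose c := 2 * `|v 0 i| + 1.
have c0 : 0 < c by rewrite /c; have := normr_ge0 (v 0 i); lra.
have epsc : 0 < eps / c by rewrite divr_gt0.
have [C HC] := axis_entropy _ _ (is_partition_join (w := box) mP) _ epsc.
exists (eps / c + C) => t t0 /=.
set K := Num.truncn (t * `|v 0%R i|).
apply: (@le_trans _ _ (eps / c * (K + K).+1%:R + C)).
  apply: le_trans (HC (- K%:Z) (K + K).+1).
  apply: entropy_determined.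
  - exact: is_partition_join.
  - by apply: is_partition_join; apply: is_partition_join.
  move=> x y /ffunP exy; apply/ffunP => w; rewrite !ffunE.
  have wi : (`|val w 0%R i| <= K)%N by exact: (window_axis v U U_axis t0 (valP w)).
  have wj j : j != i -> (`|val w 0%R j| <= r)%N.
    exact: (window_cross v U v_axis j m0 (valP w)).
  pose j : 'I_(K + K).+1 := inord `|(val w 0%R i + K%:Z)%R|%N.
  pose b : {ffun 'I_d -> 'I_(r + r).+1} :=
    [ffun j => inord `|(val w 0%R j + r%:Z)%R|%N].
  (* A window point splits into its cross-section part and its part along the axis, both shifted to
     natural indices. *)
  have -> : val w = box b + (- K%:Z + j%:Z) *: e.
    apply/rowP => k; rewrite !mxE; case: eqVneq => [->|ki] /=.
      rewrite mulr1 add0r inordK; move: wi; move: (val w 0 i) => z; lia.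
    rewrite mulr0 addr0 ffunE inordK; move: (wj k ki);
      move: (val w 0 k) => z; lia.
  have := exy j; rewrite !ffunE => /ffunP /(_ b); rewrite !ffunE.
  by rewrite !TD.
have Kt : K%:R <= t * `|v 0 i| by rewrite truncn_le // mulr_ge0 // ltW.
rewrite addrA lerD2r -natr1 natrD mulrDr mulr1 lerD2r.
rewrite mulrAC ler_pdivrMr // -mulrA ler_pM2l // /c; lra.
Qed.

End DirectionalEntropy.

Theorem theorem4p2 (R : realType) (disp : measure_display)
    (X : measurableType disp) (mu : probability X R) (d : nat)
    (T : 'rV[int]_d -> X -> X) :
  lebesgue_space mu -> (1 <= d)%N -> rectangular_rank_one mu T ->
  exists V : {vspace 'rV[R]_d},
    \dim V = 1%N /\
    (forall (v : 'rV[R]_d) (U : 'M[R]_(d.-1, d)),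
       orthonormal_basis [set` V] v -> orthonormal_basis (orth_compl V) U ->
       h1 mu T v U = 0%E).
Proof.
move=> _ d0 rank1; have [i axis_entropy] := linear_entropy d0 rank1.
have [Rk [_ _ [act _]]] := rank1.
pose e := delta_mx 0 i : 'rV[R]_d.
have eE j : e 0 j = (j == i)%:R by rewrite mxE.
exists <[e]>%VS; split.
  rewrite dim_vline; apply/eqP; rewrite eqb1; apply/eqP => /rowP /(_ i) /eqP.
  by rewrite eE mxE eqxx oner_eq0.
(* For any choice of bases, [v] is a multiple of [e], and the rows of [U], being orthogonal to [e],
   vanish at [i]. *)
move=> v U [_ Vv] [_ VU]; rewrite /h1; case: eqP => [d1|_].
  exact: ks_entropy_eq0 act _ axis_entropy d1.
apply: (dir_entropy_eq0 act _ axis_entropy) => [j ji|k].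
  have : [set` <[e]>%VS] v by rewrite Vv; exists 1%:M; rewrite ?mul1mx.
  by move=> /= /vlineP [c ->]; rewrite mxE eE (negbTE ji) mulr0.
have : orth_compl <[e]>%VS (row k U).
  by rewrite VU; exists (delta_mx 0 k); rewrite // rowE.
move=> /(_ e (memv_line e)) /rowP /(_ 0); rewrite !mxE (bigD1 i) //= big1.
  by rewrite !mxE !eqxx mulr1 addr0.
by move=> j ji; rewrite !mxE (negbTE ji) andbF mulr0.
Qed.
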